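(* Let $n,d,r$ be positive integers and let $\mathcal{G}(\mathcal{V},\mathcal{E})$ be a chordal graph with $\mathcal{V}=\{1,\dots,r\}$ and maximal cliques $\{\mathcal{C}_1,\mathcal{C}_2,\ldots,\mathcal{C}_t\}$. Let $P(x)$ be a symmetric $r\times r$ matrix of real polynomials in $x=(x_1,\dots,x_n)$ with $P_{ij}(x)=P_{ji}(x)=0$ for $(i,j)\notin\mathcal{E}^*$ (the zero entries representing unspecified entries). Then $P(x)\in\Sigma_{n,2d}^r(\mathcal{E},?)$ if and only if $$P_k(x):=E_{\mathcal{C}_k}P(x)E_{\mathcal{C}_k}^{\mathsf T}\in\Sigma_{n,2d}^{|\mathcal{C}_k|},\qquad k=1,\ldots,t,$$ and there exist positive semidefinite Gram matrices $Q_k$ of $P_k(x)$, $k=1,\dots,t$, satisfying the consistency condition $$E_{\widetilde{\mathcal{C}}_i\cap\widetilde{\mathcal{C}}_j}\left(E_{\widetilde{\mathcal{C}}_i}^{\mathsf T}Q_iE_{\widetilde{\mathcal{C}}_i}-E_{\widetilde{\mathcal{C}}_j}^{\mathsf T}Q_jE_{\widetilde{\mathcal{C}}_j}\right)E_{\widetilde{\mathcal{C}}_i\cap\widetilde{\mathcal{C}}_j}^{\mathsf T}=0\qquad\text{for all } i,j\in\{1,\dots,t\}\text{ with }\widetilde{\mathcal{C}}_i\cap\widetilde{\mathcal{C}}_j\neq\emptyset,$$ where $N=\binom{n+d}{d}$ and $\widetilde{\mathcal{C}}_k=\{(j-1)N+1,\ldots,jN \mid j\in\mathcal{C}_k\}\subseteq\{1,\dots,rN\}$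 for $k=1,\dots,t$.
   Context: Graphs. $\mathcal{G}(\mathcal{V},\mathcal{E})$ is an undirected graph with node set $\mathcal{V}=\{1,\dots,r\}$ and edge set $\mathcal{E}\subseteq\mathcal{V}\times\mathcal{V}$, where $(i,j)\in\mathcal{E}\Leftrightarrow(j,i)\in\mathcal{E}$. It is chordal if every cycle of length at least four has a chord (an edge joining two nonconsecutive nodes of the cycle). A clique is a subset $\mathcal{C}\subseteq\mathcal{V}$ with $(i,j)\in\mathcal{E}$ for all $i,j\in\mathcal{C}$, $i\ne j$; it is maximal if it is not a proper subset of another clique. Put $\mathcal{E}^*=\mathcal{E}\cup\{(i,i): i\in\mathcal{V}\}$. Index matrices. For a nonempty subset $\mathcal{C}\subseteq\{1,\dots,m\}$, let $\mathcal{C}(i)$ denote its $i$-th element in the natural ordering. The matrix $E_{\mathcal{C}}\in\mathbb{R}^{|\mathcal{C}|\times m}$ is defined by $(E_{\mathcal{C}})_{ij}=1$ if $\mathcal{C}(i)=j$ and $0$ otherwise. Here $m=r$ for the cliques $\mathcal{C}_k$, and $m=rN$ for the sets $\widetilde{\mathcal{C}}_k$ and their intersections. SOS matrices. $\mathbb{R}[x]_{n,m}$ is the set of real polynomials in $n$ variables of degree at most $m$, and $\mathbb{R}[x]_{n,m}^{q\times s}$ is the set of $q\times s$ matrices with entries in $\mathbb{R}[x]_{n,m}$. A symmetric $P(x)\in\mathbb{R}[x]_{n,2d}^{q\times q}$ is an SOS matrix if there exist a positive integer $s$ and $M(x)\in\mathbb{R}[x]_{n,d}^{s\times q}$ with $P(x)=M(x)^{\mathsf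 T}M(x)$. The set of $q\times q$ SOS matrices with entries in $\mathbb{R}[x]_{n,2d}$ is denoted $\Sigma_{n,2d}^{q}$. Gram matrices. Let $N=\binom{n+d}{d}$ and let $v_d(x)=[1,x_1,\ldots,x_n,x_1^2,x_1x_2,\ldots,x_n^d]^{\mathsf T}$ be the vector of all $N$ monomials of degree at most $d$. A Gram matrix of a $q\times q$ polynomial matrix $P(x)$ is a symmetric positive semidefinite $qN\times qN$ real matrix $Q$ with $P(x)=(I_q\otimes v_d(x))^{\mathsf T}Q\,(I_q\otimes v_d(x))$. (It is known that $P(x)\in\Sigma_{n,2d}^q$ if and only if $P(x)$ has such a Gram matrix; Gram matrices are generally not unique.) SOS completable matrices. $\Sigma_{n,2d}^r(\mathcal{E},?)$ is the set of symmetric polynomial matrices $P(x)$ of size $r\times r$ with $P_{ij}(x)=P_{ji}(x)=0$ for $(i,j)\notin\mathcal{E}^*$ for which there exists $F(x)\in\Sigma_{n,2d}^r$ with $F_{ij}(x)=P_{ij}(x)$ for all $(i,j)\in\mathcal{E}^*$. *)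

(* Defs.v *)
From mathcomp Require Import all_boot all_order all_algebra.
From mathcomp Require Export reals.
From mathcomp Require Export mxtens.
From mathcomp Require Export mpoly.

Set Implicit Arguments.
Unset Strict Implicit.
Unset Printing Implicit Defensive.

Import Order.TTheory GRing.Theory Num.Theory.
Local Open Scope ring_scope.

(* A graph on 'I_r is a symmetric relation e. Loops are allowed, as edge sets
   are arbitrary symmetric subsets of V x V; none of the notions below depends
   on them. *)
Section Graphs.
Variable r : nat.
Implicit Types (e : rel 'I_r) (A : {set 'I_r}).

Definition edge_or_diag e : rel 'I_r := fun i j => (i == j) || e i j.

Definition chordal e : Prop :=
  forall p : seq 'I_r, ucycle e p -> (4 <= size p)%N ->
    exists x y, [/\ x \in p, y \in p & x != y] /\
                [/\ y != next p x, x != next p y & e x y].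

Definition clique e : pred {set 'I_r} := fun A =>
  [forall i in A, forall j in A, (i != j) ==> e i j].

Definition maximal_clique e A : bool := maxset (clique e) A.

(* C lists the maximal cliques C_1, ..., C_t, each of them once. *)
Definition maximal_cliques_are e t (C : 'I_t -> {set 'I_r}) : Prop :=
  injective C /\ forall A, maximal_clique e A <-> exists k, C k = A.

End Graphs.

(* enum_val lists the elements of a set of ordinals in increasing order. The
   entries live in an arbitrary ring K, so as to multiply both real and
   polynomial matrices. *)
Definition index_mx (K : nzRingType) (m : nat) (A : {set 'I_m}) :
    'M[K]_(#|A|, m) :=
  \matrix_(i, j) (enum_val i == j)%:R.

(* In 0-based indices, block j of {0, ..., r N - 1} is [j N, (j + 1) N). *)
Definition blowup (r N : nat) (A : {set 'I_r}) : {set 'I_(r * N)} :=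
  [set i : 'I_(r * N) | [exists j in A, (j * N <= i < j.+1 * N)%N]].

Lemma card_blowup r N (A : {set 'I_r}) : #|blowup N A| = (#|A| * N)%N.
Proof.
have -> : blowup N A
  = [set mxtens_index ij | ij in setX A [set: 'I_N]].
  apply/setP => i; rewrite inE; apply/existsP/imsetP.
    case=> j /and3P[jA le_i lt_i]; have N0 : (0 < N)%N.
      by case: posnP lt_i => // N0; rewrite [in X in (_ < X)%N]N0 muln0.
    have Ej : j = (i %/ N)%N :> nat.
      apply/eqP; rewrite eqn_leq -ltnS; apply/andP; split.
        by rewrite ltnS leq_divRL.
      by rewrite -ltnS ltn_divLR.
    exists (mxtens_unindex i); last by rewrite mxtens_unindexK.
    rewrite !inE andbT; suff -> : (mxtens_unindex i).1 = j by [].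
    exact: val_inj.
  case=> -[j l] /setXP[jA _] ->; exists j => /=; rewrite jA /= leq_addr /=.
  by rewrite mulSn addnC ltn_add2r.
rewrite card_imset ?cardsX ?cardsT ?card_ord //.
exact: (can_inj (@mxtens_indexK r N)).
Qed.

(* index_mx of the blow-up of A, with |A| N rather than #|blowup N A| rows. *)
Definition blowup_mx (K : nzRingType) (r N : nat) (A : {set 'I_r}) :
    'M[K]_(#|A| * N, r * N) :=
  castmx (card_blowup N A, erefl) (index_mx K (blowup N A)).

Section Monomials.
Variable n : nat.
Implicit Type m : 'X_{1..n}.

(* By increasing degree and, in each degree, 'X_0 first: the order on
   'X_{1..n} at equal degrees is the lexicographic one, hence is reversed. *)
Definition monomial_le : rel 'X_{1..n} := fun m1 m2 =>
  (mdeg m1 < mdeg m2)%N || ((mdeg m1 == mdeg m2) && (m2 <= m1)%O).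

Definition monomials (d : nat) : seq 'X_{1..n} :=
  sort monomial_le [seq val m | m : 'X_{1..n < d.+1}].

Lemma monomial_le_trans : transitive monomial_le.
Proof.
move=> y x z /orP[lt1|/andP[/eqP e1 l1]] /orP[lt2|/andP[/eqP e2 l2]];
  apply/orP.
- by left; apply: ltn_trans lt2.
- by left; rewrite -e2.
- by left; rewrite e1.
- by right; rewrite e1 e2 eqxx (le_trans l2 l1).
Qed.

Lemma monomial_le_total : total monomial_le.
Proof.
move=> x y; rewrite /monomial_le (eq_sym (mdeg y)).
by case: ltngtP => //= _; apply: le_total.
Qed.

Lemma monomials_sorted d : sorted monomial_le (monomials d).
Proof. exact/sort_sorted/monomial_le_total. Qed.

Lemma monomials_uniq d : uniq (monomials d).
Proof. by rewrite sort_uniq map_inj_uniq ?enum_uniq //; apply: val_inj. Qed.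

Lemma mem_monomials d m : (m \in monomials d) = (mdeg m <= d)%N.
Proof.
rewrite mem_sort; apply/mapP/idP => [[[m' lt_m'] _ ->] // | le_m].
by exists (BMultinom (le_m : (mdeg m < d.+1)%N)); rewrite ?mem_enum.
Qed.

Lemma size_monomials d : size (monomials d) = 'C(n + d, d).
Proof.
rewrite size_sort size_map -cardE -bin_sub ?leq_addl // addnK.
rewrite -card_partial_ord_partitions.
pose f (m : 'X_{1..n < d.+1}) : n.-tuple 'I_d.+1 :=
  [tuple inord (val m i) | i < n].
have le_d (m : 'X_{1..n < d.+1}) i : (val m i < d.+1)%N.
  by apply: leq_ltn_trans (bmdeg m); rewrite mdegE (bigD1 i) //= leq_addr.
have f_inj : injective f.
  move=> m1 m2 /(congr1 (fun t => tnth t)) Ef; apply/val_inj/mnmP => i.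
  move: (congr1 (fun g => val (g i)) Ef).
  by rewrite !tnth_mktuple /= !inordK // le_d.
rewrite -(card_imset _ f_inj); apply: eq_card => t; rewrite inE.
apply/imsetP/idP => [[m _ ->] | le_t].
  rewrite big_tuple; under eq_bigr => i _ do
    rewrite tnth_mktuple inordK ?le_d //.
  by rewrite -mdegE -ltnS bmdeg.
have lt_m : (mdeg [multinom (tnth t i : nat) | i < n] < d.+1)%N.
  rewrite ltnS mdegE; under eq_bigr => i _ do rewrite mnmE.
  by rewrite big_tuple in le_t.
exists (BMultinom lt_m) => //; apply/eq_from_tnth => i.
by apply: val_inj; rewrite tnth_mktuple /= mnmE inordK.
Qed.

End Monomials.

Section SOS.
Variables (R : realType) (n : nat).

(* msize p is 1 + deg p, and 0 for p = 0. *)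
Definition deg_le (m : nat) (q s : nat) (M : 'M[{mpoly R[n]}]_(q, s)) : Prop :=
  forall i j, (msize (M i j) <= m.+1)%N.

(* P belongs to Sigma_{n,2d}^q. *)
Definition sos_mx (d q : nat) (P : 'M[{mpoly R[n]}]_q) : Prop :=
  [/\ P^T = P, deg_le (2 * d) P &
      exists s : nat, (0 < s)%N /\
        exists M : 'M[{mpoly R[n]}]_(s, q), deg_le d M /\ P = M^T *m M].

Definition psd_mx (m : nat) (Q : 'M[R]_m) : Prop :=
  Q^T = Q /\ forall v : 'cV[R]_m, 0 <= (v^T *m Q *m v) 0 0.

Definition nb_monomials (d : nat) : nat := 'C(n + d, d).

Definition monomial_vect (d : nat) : 'cV[{mpoly R[n]}]_(nb_monomials d) :=
  \col_(i < nb_monomials d) 'X_[nth 0%MM (monomials n d) i].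

(* I_q (x) v_d(x) *)
Definition monomial_mx (d q : nat) :
    'M[{mpoly R[n]}]_(q * nb_monomials d, q) :=
  castmx (erefl, muln1 q) (tensmx 1%:M (monomial_vect d)).

Definition gram_mx (d q : nat) (P : 'M[{mpoly R[n]}]_q)
    (Q : 'M[R]_(q * nb_monomials d)) : Prop :=
  psd_mx Q /\
  P = (monomial_mx d q)^T *m map_mx (@mpolyC n R) Q *m monomial_mx d q.

(* P belongs to Sigma_{n,2d}^r(E,?). *)
Definition sos_completable (r : nat) (e : rel 'I_r) (d : nat)
    (P : 'M[{mpoly R[n]}]_r) : Prop :=
  [/\ P^T = P,
      forall i j, ~~ edge_or_diag e i j -> P i j = 0 /\ P j i = 0 &
      exists F : 'M[{mpoly R[n]}]_r, sos_mx d F /\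
        forall i j, edge_or_diag e i j -> F i j = P i j].

End SOS.

(* Main.v *)
(* Writing v for the monomial vector, an SOS matrix F is (I (x) v)^T Z (I (x) v)
   with Z positive semidefinite, and restricting F to a clique C_k restricts Z
   to the rows and columns of the blow-up of C_k. So consistent Gram matrices
   Q_k are the specified blocks of a partial matrix Z whose pattern is the
   blow-up of the graph, and the theorem amounts to completing that partial
   matrix to a positive semidefinite one.

   The completion is by induction on the vertex set U. If U is not a clique, a
   minimal separator S of two nonadjacent vertices is a clique: two nonadjacent
   vertices of S would be joined by chordless paths on both sides of S, that is,
   lie on a chordless cycle. So U is the union of two proper subsets that meet
   in a clique, with no other edge between them. Completions X and Y on the two
   parts share a block T on S. As X and Y are positive semidefinite, their
   columns over S are K T and L T for some K and L, and filling the missing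
   block with K T L^T makes the union positive semidefinite, being the sum of
   [K; L] T [K; L]^T and of the two Schur complements. *)
Require Import Defs.
From mathcomp Require Import all_boot all_order all_algebra.
From mathcomp Require Import ring zify.

Set Implicit Arguments.
Unset Strict Implicit.
Unset Printing Implicit Defensive.

Import Order.TTheory GRing.Theory Num.Theory.
Local Open Scope ring_scope.

(** * Chordless paths in chordal graphs *)

Section Paths.
Local Open Scope nat_scope.
Variables (T : finType).

(** A walk of minimal length has no chords, since a chord would shorten it. Positions are counted in
    [x :: p], so position 0 is [x]. *)
Lemma connect_induced_path (e : rel T) x y : connect e x y ->
  exists p, [/\ path e x p, last x p = y, uniq (x :: p) &
    forall i j, i.+1 < j <= size p ->
      ~~ e (nth x (x :: p) i) (nth x (x :: p) j)].
Proof.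
move=> /connectP[p0 p0P p0l].
pose P k := [exists p : k.-tuple T, path e x p && (last x p == y)].
have inP s : path e x s -> last x s = y -> P (size s).
  by move=> sP sl; apply/existsP; exists (in_tuple s); rewrite /= sP sl /=.
have exP : exists k, P k by exists (size p0); apply: inP.
case: (ex_minnP exP) => k /existsP[q /andP[qP ql]] kmin.
have min s : path e x s -> last x s = y -> size q <= size s.
  by move=> sP sl; rewrite size_tuple; apply/kmin/inP.
move: ql; case: (shortenP qP) => p pP pu subp /eqP pl.
have le_p : size p <= size q.
  by apply: uniq_leq_size subp; case/andP: pu.
exists p; split=> // i [|j] /andP[lt_ij le_j] //.
apply/negP => /= eij.
have dj := drop_nth x le_j.
have le_i : i <= size p by apply: leq_trans (ltnW le_j); rewrite -ltnS ltnW.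
have li : last x (take i p) = nth x (x :: p) i.
  case: i le_i {lt_ij eij} => [|i] le_i; first by rewrite take0.
  by rewrite (take_nth x) // last_rcons.
have pE : p = take j p ++ drop j p by rewrite cat_take_drop.
(* The shortcut jumps from position [i] straight to position [j.+1] and contradicts the minimal
   length. *)
have := min (take i p ++ drop j p).
rewrite cat_path li take_path // last_cat dj /= eij.
move: (pP) (pl); rewrite {1 2}pE cat_path last_cat dj /=.
move=> /and3P[_ _ ->] -> /(_ isT erefl).
rewrite size_cat /= size_takel // size_drop => le_q.
move: (leq_trans le_p le_q) lt_ij le_j; move: (size p) => z; lia.
Qed.

(** This treats one arc [x :: p] of a cycle: positions one apart are consecutive on the cycle, and
    positions further apart are nonadjacent because the arc is chordless. *)
Lemma no_chord_on_path (e : rel T) x p q u w :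
  symmetric e -> uniq (x :: p ++ q) ->
  (forall i j, i.+1 < j <= size p ->
     ~~ e (nth x (x :: p) i) (nth x (x :: p) j)) ->
  u \in x :: p -> w \in x :: p -> u != w ->
  w != next (x :: p ++ q) u -> u != next (x :: p ++ q) w -> ~~ e u w.
Proof.
move=> e_sym c_uniq ind u_p w_p neq_uw.
wlog lt_uw : u w u_p w_p neq_uw / index u (x :: p) < index w (x :: p).
  move=> th; case: (ltngtP (index u (x :: p)) (index w (x :: p))) => [lt|gt|eq].
  - exact: th.
  - by move=> nw nu; rewrite e_sym; apply: th => //; rewrite eq_sym.
  - by case/eqP: neq_uw; rewrite -(nth_index x u_p) eq nth_index.
move=> not_next _; rewrite -(nth_index x u_p) -(nth_index x w_p).
have le_size v : v \in x :: p -> index v (x :: p) <= size p.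
  by rewrite -index_mem ltnS.
apply: ind; rewrite le_size // andbT ltn_neqAle lt_uw andbT.
apply: contraNneq not_next => Ew.
rewrite next_nth -cat_cons mem_cat u_p /=.
rewrite -[if _ then _ else _]/(index u ((x :: p) ++ q)).
rewrite index_cat u_p nth_cat.
have ltp : index u (x :: p) < size p.
  by apply: leq_trans lt_uw _; apply: le_size.
by rewrite ltp -[nth x p _]/(nth x (x :: p) _.+1) Ew nth_index.
Qed.

Definition induced (e : rel T) (X : {set T}) : rel T :=
  [rel u v | [&& u \in X, v \in X & e u v]].

Lemma induced_sym (e : rel T) X : symmetric e -> symmetric (induced e X).
Proof. by move=> e_sym u v; rewrite /induced /= e_sym andbCA. Qed.

Lemma path_induced (e : rel T) (X : {set T}) x p :
  path (induced e X) x p -> {subset p <= X} /\ path e x p.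
Proof.
elim: p x => [|y p IHp] x /=; first by split.
case/andP=> /and3P[_ yX exy] /IHp[pX ->]; rewrite exy; split=> // z.
by rewrite inE => /predU1P[->|/pX].
Qed.

(** A chordless path in the graph induced on [A] with [x] and [y] added is chordless in [e] too. It
    meets its ends only once, so its interior [p] stays in [A], and [p] is nonempty because [x] and
    [y] are not adjacent. *)
Lemma connect_through (e : rel T) (A : {set T}) x y :
    symmetric e -> x \notin A -> y \notin A -> x != y -> ~~ e x y ->
    connect (induced e (x |: (y |: A))) x y ->
  exists p, [/\ path e x (rcons p y), p != [::], uniq (x :: rcons p y),
    {subset p <= A} & forall i j, i.+1 < j <= size (rcons p y) ->
      ~~ e (nth x (x :: rcons p y) i) (nth x (x :: rcons p y) j)].
Proof.
move=> e_sym xA yA neq_xy nexy /connect_induced_path[p [pP pl pu pI]].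
case/path_induced: (pP) => pX pe.
case/lastP: p => [|p z] in pP pl pu pI pX pe *.
  by rewrite /= in pl; rewrite pl eqxx in neq_xy.
rewrite last_rcons in pl; rewrite {z}pl in pP pu pI pX pe *.
have pX' : {subset x :: rcons p y <= x |: (y |: A)}.
  by move=> v; rewrite inE => /predU1P[->|/pX //]; rewrite !inE eqxx.
exists p; split=> //.
- by case: p pe {pP pu pI pX pX'} => //=; rewrite (negPf nexy).
- move=> v vp; have /pX : v \in rcons p y by rewrite mem_rcons inE vp orbT.
  rewrite !inE => /or3P[/eqP vx|/eqP vy|//].
    by move: pu; rewrite /= mem_rcons inE -vx vp orbT.
  by move: pu; rewrite /= rcons_uniq -vy vp /= andbF.
move=> i j /[dup] ij /pI; apply: contra => eij; apply/and3P; split=> //.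
  apply/pX'/mem_nth; case/andP: ij => lt_ij le_j.
  by rewrite ltnS ltnW // ltnW // (leq_trans lt_ij).
by apply/pX'/mem_nth; case/andP: ij.
Qed.

End Paths.

(** If [x] and [y] were not adjacent, chordless paths through [A] and through [B] would close up to
    a cycle of length at least 4. A chord could neither join two vertices of one path nor run from
    [A] to [B]. *)
Lemma chordal_adjacent r (e : rel 'I_r) (A B : {set 'I_r}) x y :
    symmetric e -> chordal e -> [disjoint A & B] ->
    {in A & B, forall u v, ~~ e u v} ->
    x \notin A :|: B -> y \notin A :|: B -> x != y ->
    connect (induced e (x |: (y |: A))) x y ->
    connect (induced e (x |: (y |: B))) x y ->
  e x y.
Proof.
move=> e_sym e_ch dAB nAB; rewrite !inE !negb_or => /andP[xA xB] /andP[yA yB].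
move=> neq_xy cA cB; apply/negPn/negP => nexy.
have [p [pP p0 pu pA pI]] := connect_through e_sym xA yA neq_xy nexy cA.
have cB' : connect (induced e (y |: (x |: B))) y x.
  by rewrite setUCA (sym_connect_sym (induced_sym _ e_sym)).
have neyx : ~~ e y x by rewrite e_sym.
have neq_yx : y != x by rewrite eq_sym.
have [q [qP q0 qu qB qI]] := connect_through e_sym yB xB neq_yx neyx cB'.
pose c := x :: rcons p y ++ q.
have c_uniq : uniq c.
  rewrite /c -cat_cons cat_uniq pu /=; apply/andP; split; last first.
    by move: qu; rewrite /= rcons_uniq => /and3P[].
  apply/hasPn => v vq; have vB := qB v vq.
  rewrite inE mem_rcons inE !negb_or; apply/and3P; split.
  - by apply: contraNneq xB => <-.
  - by apply: contraNneq yB => <-.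
  - by apply: contraL vB => /pA vA; rewrite (disjointFr dAB vA).
have c_cycle : cycle e c.
  by rewrite /c /= rcons_cat cat_path pP last_rcons.
have c_ucycle : ucycle e c by apply/andP.
have [|u [w [[uc wc neq_uw] [nwu nuw euw]]]] := e_ch c c_ucycle.
  rewrite /c /= size_cat size_rcons.
  by case: (p) p0 => // a p' _; case: (q) q0 => //= b q' _; rewrite addnS.
(* Rotating the cycle to start at [y] makes the second path its initial arc. *)
have rotc : rot (size p).+1 c = y :: rcons q x ++ p.
  rewrite /c -cats1 -catA -cat_cons -[(size p).+1]/(size (x :: p)).
  by rewrite rot_size_cat /= cat_rcons.
have onp u' w' : u' \in x :: rcons p y -> w' \in x :: rcons p y -> u' != w' ->
    w' != next c u' -> u' != next c w' -> ~~ e u' w'.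
  by move=> *; apply: no_chord_on_path c_uniq pI _ _ _ _ _.
have onq u' w' : u' \in y :: rcons q x -> w' \in y :: rcons q x -> u' != w' ->
    w' != next c u' -> u' != next c w' -> ~~ e u' w'.
  move=> u'q w'q neq'; rewrite -!(next_rot (size p).+1 c_uniq) rotc => n1 n2.
  by apply: no_chord_on_path qI _ _ _ n1 n2; rewrite // -rotc rot_uniq.
have c_p v : v \in c -> (v \in x :: rcons p y) || (v \in q).
  by rewrite /c -cat_cons mem_cat.
have c_q v : v \in c -> (v \in p) || (v \in y :: rcons q x).
  by rewrite -(mem_rot (size p).+1) rotc -cat_cons mem_cat orbC.
have no : ~~ e u w -> False by rewrite euw.
case/orP: (c_q u uc) => [up|uq].
  have /orP[wp|wq] := c_p w wc; apply: no; last exact: nAB (pA u up) (qB w wq).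
  by apply: onp => //; rewrite inE mem_rcons inE up !orbT.
have /orP[wp|wq] := c_q w wc; apply: no; last exact: onq.
have /orP[up|u_q] := c_p u uc.
  by apply: onp => //; rewrite inE mem_rcons inE wp !orbT.
by rewrite e_sym; apply: nAB (pA w wp) (qB u u_q).
Qed.

(** * Gluing positive semidefinite matrices *)

Section PSD.
Variable R : realType.

Lemma psd_congr m p (Z : 'M[R]_m) (B : 'M[R]_(m, p)) :
  psd_mx Z -> psd_mx (B^T *m Z *m B).
Proof.
move=> [Zs Zp]; split; first by rewrite !trmx_mul trmxK Zs mulmxA.
by move=> v; have := Zp (B *m v); rewrite trmx_mul !mulmxA.
Qed.

Lemma psdD m (Y Z : 'M[R]_m) : psd_mx Y -> psd_mx Z -> psd_mx (Y + Z).
Proof.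
move=> [Ys Yp] [Zs Zp]; split; first by rewrite linearD /= Ys Zs.
by move=> v; rewrite mulmxDr mulmxDl mxE addr_ge0.
Qed.

Lemma psd_gram m s (L : 'M[R]_(s, m)) : psd_mx (L^T *m L).
Proof.
split=> [|v]; first by rewrite trmx_mul trmxK.
have -> : v^T *m (L^T *m L) *m v = (L *m v)^T *m (L *m v).
  by rewrite trmx_mul !mulmxA.
by rewrite mxE sumr_ge0 // => i _; rewrite mxE -expr2 sqr_ge0.
Qed.

Lemma gram_eq0 m (v : 'cV[R]_m) : (v^T *m v) 0 0 = 0 -> v = 0.
Proof.
rewrite mxE => /eqP; rewrite psumr_eq0 => [/allP v0|i _]; last first.
  by rewrite mxE -expr2 sqr_ge0.
apply/matrixP=> i j; rewrite (ord1 j) !mxE.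
by have := v0 i (mem_index_enum i); rewrite mxE mulf_eq0 orbb => /eqP.
Qed.

Lemma psd_col_eq0 m (Z : 'M[R]_m) (v : 'cV[R]_m) :
  psd_mx Z -> (v^T *m Z *m v) 0 0 = 0 -> Z *m v = 0.
Proof.
move=> [Zs Zp] v0; set w := Z *m v.
apply: gram_eq0; set c : R := _ 0 0; set b : R := (w^T *m Z *m w) 0 0.
have wv : w^T *m Z *m v = w^T *m w by rewrite -mulmxA.
have vw : v^T *m Z *m w = w^T *m w by rewrite /w trmx_mul Zs.
(* s is the coefficient of w in the nonnegative form at v + s w: the linear
   term 2 s c forces c = 0. *)
have quad s : 0 <= s * c *+ 2 + s ^+ 2 * b.
  have := Zp (v + s *: w).
  have -> : (v + s *: w)^T = v^T + s *: w^T.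
    by apply/matrixP=> i j; rewrite !mxE.
  rewrite !(mulmxDl, mulmxDr) -!(scalemxAl, scalemxAr) vw wv.
  have addE (A B : 'M[R]_1) : (A + B) 0 0 = A 0 0 + B 0 0 by rewrite mxE.
  have scaleE a (A : 'M[R]_1) : (a *: A) 0 0 = a * A 0 0 by rewrite mxE.
  rewrite !(addE, scaleE) v0 -/c -/b; congr (0 <= _); ring.
have b0 : 0 <= b by apply: Zp.
have b1 : 0 < b + 1 by rewrite ltr_wpDl.
have b2 : 0 < b + 2 by rewrite ltr_wpDl.
have := quad (- c / (b + 1)).
(* The minimizer would be [- c / b]; the denominator [b + 1] also covers [b = 0] and still yields a
   negative multiple of [c ^+ 2]. *)
have -> : - c / (b + 1) * c *+ 2 + (- c / (b + 1)) ^+ 2 * b =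
   - (c ^+ 2 * ((b + 2) / (b + 1) ^+ 2)) by field; rewrite gt_eqF.
rewrite oppr_ge0 pmulr_lle0; last by rewrite divr_gt0 ?exprn_gt0.
by move=> c2; apply/eqP; rewrite -sqrf_eq0 eq_le c2 sqr_ge0.
Qed.

Lemma psd_mul_eq0 m p (Z : 'M[R]_m) (W : 'M[R]_(m, p)) :
  psd_mx Z -> W^T *m Z *m W = 0 -> Z *m W = 0.
Proof.
move=> Zp W0; apply/matrixP=> i j.
have : Z *m (W *m delta_mx j (0 : 'I_1)) = 0.
  apply: psd_col_eq0 => //.
  rewrite trmx_mul !mulmxA -(mulmxA _ W^T) -(mulmxA _ (W^T *m Z)) W0.
  by rewrite mulmx0 mul0mx mxE.
by rewrite mulmxA -colE => /(congr1 (fun A : 'cV_m => A i 0)); rewrite !mxE.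
Qed.

Lemma psd_schur m p (Z : 'M[R]_m) (D : 'M[R]_(m, p)) K :
  psd_mx Z -> Z *m D = K *m (D^T *m Z *m D) ->
  psd_mx (Z - K *m (D^T *m Z *m D) *m K^T).
Proof.
move=> Zp ZD; set T := D^T *m Z *m D in ZD *.
suff -> : Z - K *m T *m K^T = (1%:M - D *m K^T)^T *m Z *m (1%:M - D *m K^T).
  exact: psd_congr.
have Ts : T^T = T by rewrite /T !trmx_mul trmxK (proj1 Zp) mulmxA.
have DZ : D^T *m Z = T *m K^T.
  by rewrite -[LHS]trmxK trmx_mul trmxK (proj1 Zp) ZD trmx_mul Ts.
have -> : (1%:M - D *m K^T)^T = 1%:M - K *m D^T.
  by rewrite linearB /= trmx1 trmx_mul trmxK.
have DZD : D^T *m Z *m D = T by [].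
clearbody T; rewrite mulmxBl mul1mx -[K *m D^T *m Z]mulmxA DZ mulmxA.
rewrite mulmxBr mulmx1 [_ *m (D *m _)]mulmxA (mulmxBl _ _ D) ZD.
rewrite -[K *m T *m K^T]mulmxA -DZ.
by rewrite -[K *m (D^T *m Z) *m D]mulmxA DZD subrr mul0mx subr0.
Qed.

Lemma psd_diag_eq0 m (Z : 'M[R]_m) i : psd_mx Z -> Z i i = 0 -> col i Z = 0.
Proof.
move=> Zp Zi; rewrite colE; apply: psd_col_eq0 => //.
by rewrite -mulmxA -colE trmx_delta -rowE !mxE.
Qed.

(** Induction on the number of nonzero diagonal entries, splitting off one rank-one term at a time.
    The row count [s.+1] is positive, as the definition of an SOS matrix asks. *)
Lemma psd_factor m (Z : 'M[R]_m) :
  psd_mx Z -> exists s, exists L : 'M[R]_(s.+1, m), Z = L^T *m L.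
Proof.
have [k] := ubnP #|[set i | Z i i != 0]|.
elim: k Z => // k IHk Z le_k Zp.
(* A Schur complement at a nonzero diagonal entry i clears it, and keeps the
   zero ones as these have zero columns. *)
have [Z0|[i Zi]] := set_0Vmem [set i | Z i i != 0].
  exists 0, 0; rewrite mulmx0; apply/matrixP => i j; rewrite mxE.
  have : j \notin [set i | Z i i != 0] by rewrite Z0 inE.
  rewrite inE negbK => /eqP/(psd_diag_eq0 Zp)/(congr1 (fun A : 'cV_m => A i 0)).
  by rewrite !mxE.
rewrite inE in Zi.
have Zi_gt0 : 0 < Z i i.
  rewrite lt_def Zi; have := proj2 Zp (delta_mx i 0).
  by rewrite -mulmxA -colE trmx_delta -rowE !mxE.
pose D : 'cV[R]_m := delta_mx i 0.
have DZD : D^T *m Z *m D = (Z i i)%:M.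
  rewrite -mulmxA -colE trmx_delta -rowE; apply/matrixP => a b.
  by rewrite !ord1 !mxE eqxx.
pose K := (Z i i)^-1 *: col i Z.
have ZD : Z *m D = K *m (D^T *m Z *m D).
  by rewrite DZD mul_mx_scalar scalerA divff // scale1r colE.
have := psd_schur Zp ZD; rewrite DZD mul_mx_scalar /K scalerA divff // scale1r.
set Z' := Z - _ => Z'p.
have Z'E a b : Z' a b = Z a b - Z a i * Z b i / Z i i.
  by rewrite /Z' !mxE big_ord1 !mxE; ring.
have [|s [L ZL]] := IHk Z' _ Z'p.
  apply: leq_trans (le_k : (_ <= k)%N); apply: proper_card; apply/properP.
  split; last by exists i; rewrite !inE ?Zi // Z'E mulfK // subrr eqxx.
  apply/subsetP => a; rewrite !inE; apply: contraNneq => Za.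
  have Zia : Z i a = 0.
    have := congr1 (fun A : 'cV_m => A i 0) (psd_diag_eq0 Zp Za).
    by rewrite !mxE.
  have Zai : Z a i = 0 by rewrite -(proj1 Zp) mxE.
  by rewrite Z'E Za Zai !mul0r subr0.
(* The product [w^T *m w] is exactly the rank-one term that the Schur complement subtracted. *)
pose w := (Num.sqrt (Z i i))^-1 *: (col i Z)^T.
exists s.+1, (col_mx w L : 'M_(1 + s.+1, m)).
transitivity (w^T *m w + L^T *m L); last by rewrite -mul_row_col -tr_col_mx.
rewrite -ZL; apply/matrixP => a b.
rewrite [RHS]mxE Z'E mxE big_ord1 !mxE.
have sq : Num.sqrt (Z i i) ^+ 2 = Z i i by rewrite sqr_sqrtr // ltW.
have sqn0 : Num.sqrt (Z i i) != 0 by rewrite gt_eqF // sqrtr_gt0.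
rewrite -[X in _ / X]sq; field; exact: sqn0.
Qed.

(** The coordinate projection onto [A], kept at full size so that blocks of different index sets can
    be added without casts. *)
Definition diag_of m (A : {set 'I_m}) : 'M[R]_m :=
  diag_mx (\row_i (i \in A)%:R).

Lemma diag_of_tr m (A : {set 'I_m}) : (diag_of A)^T = diag_of A.
Proof. exact: tr_diag_mx. Qed.

Lemma diag_of_mulE m (A B : {set 'I_m}) (Z : 'M[R]_m) i j :
  (diag_of A *m Z *m diag_of B) i j = (i \in A)%:R * Z i j * (j \in B)%:R.
Proof. by rewrite mul_mx_diag mul_diag_mx !mxE. Qed.

Lemma diag_of_mul m (A B : {set 'I_m}) :
  diag_of A *m diag_of B = diag_of (A :&: B).
Proof.
rewrite mulmx_diag; congr diag_mx; apply/rowP => i.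
by rewrite !mxE inE -natrM mulnb.
Qed.

Lemma diag_of0 m : diag_of (set0 : {set 'I_m}) = 0.
Proof.
by apply/matrixP=> i j; rewrite !mxE inE mul0rn.
Qed.

Lemma psd_glue m (A B : {set 'I_m}) (X Y : 'M[R]_m) :
  psd_mx X -> psd_mx Y ->
  {in A :&: B &, forall i j, X i j = Y i j} ->
  exists Z, [/\ psd_mx Z, {in A &, forall i j, Z i j = X i j}
              & {in B &, forall i j, Z i j = Y i j}].
Proof.
move=> Xp Yp XY; set S := A :&: B in XY.
pose D := diag_of S; pose T := D^T *m X *m D.
have TY : T = D^T *m Y *m D.
  rewrite /T /D diag_of_tr; apply/matrixP => i j; rewrite !diag_of_mulE.
  have [iS|] := boolP (i \in S); last by rewrite !mul0r.
  have [jS|] := boolP (j \in S); last by rewrite !mulr0.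
  by rewrite XY.
(* If [T N = 0], the form of [W] vanishes on the columns of [D N], so [W D N = 0]. Hence the row
   space of [W D] lies in that of [T]. *)
have fact W : psd_mx W -> T = D^T *m W *m D -> exists K, W *m D = K *m T.
  move=> Wp TW; apply/submxP; rewrite submxE -mulmxA; apply/eqP.
  have := mulmx_coker T; move: (cokermx T) => N TN.
  apply: psd_mul_eq0 => //; rewrite trmx_mul !mulmxA.
  by rewrite -!(mulmxA N^T) -TW TN mulmx0.
have [K XD] := fact X Xp erefl; have [L YD] := fact Y Yp TY.
have Ts : T^T = T by rewrite /T !trmx_mul trmxK (proj1 Xp) mulmxA.
have Tp : psd_mx T by apply: psd_congr.
have RX := psd_schur Xp XD; rewrite -/T in RX.
have RY : psd_mx (Y - L *m T *m L^T).
  by have := psd_schur Yp (D := D) (K := L); rewrite -TY; apply.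
have DY : D *m Y = T *m L^T.
  by rewrite -[LHS]trmxK trmx_mul (proj1 Yp) diag_of_tr YD trmx_mul Ts.
(* The overlap is counted with [A], so the two projections are orthogonal; [M] stacks the rows of
   [K] over [A] and those of [L] over the rest of [B]. *)
pose EA := diag_of A; pose EB := diag_of (B :\: A).
pose M := EA *m K + EB *m L.
pose Z := M *m T *m M^T + EA *m (X - K *m T *m K^T) *m EA
          + EB *m (Y - L *m T *m L^T) *m EB.
have AA : EA *m EA = EA by rewrite diag_of_mul setIid.
have BB : EB *m EB = EB by rewrite diag_of_mul setIid.
have AB : EA *m EB = 0.
  by rewrite diag_of_mul setIDA setIC -setIDA setDv setI0 diag_of0.
have BA : EB *m EA = 0 by rewrite -[LHS]trmxK trmx_mul !diag_of_tr AB trmx0.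
have EAM : EA *m M = EA *m K.
  by rewrite /M mulmxDr !mulmxA AA AB mul0mx addr0.
have EBM : EB *m M = EB *m L.
  by rewrite /M mulmxDr !mulmxA BB BA mul0mx add0r.
have MEA : M^T *m EA = K^T *m EA.
  by rewrite -[LHS]trmxK trmx_mul trmxK diag_of_tr EAM trmx_mul diag_of_tr.
have MEB : M^T *m EB = L^T *m EB.
  by rewrite -[LHS]trmxK trmx_mul trmxK diag_of_tr EBM trmx_mul diag_of_tr.
have DA : D *m EA = D by rewrite diag_of_mul /S setIAC setIid.
have DB : D *m EB = 0.
  rewrite diag_of_mul; suff -> : S :&: (B :\: A) = set0 by rewrite diag_of0.
  by apply/setP => k; rewrite !inE; case: (k \in A); rewrite ?andbF.
have DM : D *m M = D *m K by rewrite /M mulmxDr !mulmxA DA DB mul0mx addr0.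
have DKT : D *m K *m T = T by rewrite -mulmxA -XD mulmxA /T diag_of_tr.
clearbody M T.
have ZE (U V : 'M_m) : U *m Z *m V =
    (U *m M) *m T *m (M^T *m V)
    + (U *m EA) *m (X - K *m T *m K^T) *m (EA *m V)
    + (U *m EB) *m (Y - L *m T *m L^T) *m (EB *m V).
  by rewrite /Z !(mulmxDr U) !(mulmxDl _ _ V) !mulmxA.
have subE (W : 'M_m) E J :
    E *m J *m T *m (J^T *m E) + E *m (W - J *m T *m J^T) *m E = E *m W *m E.
  by rewrite mulmxBr mulmxBl !mulmxA addrC subrK.
have ZA : EA *m Z *m EA = EA *m X *m EA.
  by rewrite ZE EAM MEA AA AB mul0mx mul0mx addr0 subE.
have ZB : EB *m Z *m EB = EB *m Y *m EB.
  by rewrite ZE EBM MEB BB BA mul0mx mul0mx addr0 subE.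
(* Between the overlap and the rest of [B] only the summand [M T M^T] survives; there it equals
   [T L^T], which is [D Y]. *)
have ZDB : D *m Z *m EB = D *m Y *m EB.
  rewrite ZE DB mul0mx mul0mx addr0 AB mulmx0 addr0 MEB DY.
  by rewrite DM DKT !mulmxA.
have Zp : psd_mx Z.
  have sandwich (W E : 'M[R]_m) : E^T = E -> psd_mx W -> psd_mx (E *m W *m E).
    by move=> Es Wp; have := psd_congr E Wp; rewrite Es.
  apply: psdD; last by apply: sandwich; rewrite ?diag_of_tr.
  apply: psdD; last by apply: sandwich; rewrite ?diag_of_tr.
  by have := psd_congr M^T Tp; rewrite trmxK.
have sym (W : 'M[R]_m) i j : psd_mx W -> W i j = W j i.
  by case=> Ws _; rewrite -{1}Ws mxE.
have onA : {in A &, forall i j, Z i j = X i j}.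
  move=> i j iA jA; have := congr1 (fun W : 'M_m => W i j) ZA.
  by rewrite /= !diag_of_mulE iA jA !mulr1 !mul1r.
exists Z; split=> // i j iB jB.
have entry (E F : {set 'I_m}) k l : k \in E -> l \in F ->
    diag_of E *m Z *m diag_of F = diag_of E *m Y *m diag_of F -> Z k l = Y k l.
  move=> kE lF /(congr1 (fun W : 'M_m => W k l)).
  by rewrite !diag_of_mulE kE lF !mulr1 !mul1r.
have [iA|iA] := boolP (i \in A); have [jA|jA] := boolP (j \in A).
- by rewrite onA // XY ?inE ?iA ?jA.
- by apply: entry ZDB; rewrite inE ?iA ?jA.
- by rewrite sym // (sym Y) //; apply: entry ZDB; rewrite inE ?iA ?jA.
- by apply: entry ZB; rewrite inE ?iA ?jA.
Qed.
End PSD.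

(** * Clique separators and chordal completion *)

Section Separators.
Variables (r : nat) (e : rel 'I_r) (e_sym : symmetric e).
Implicit Types (U S : {set 'I_r}) (a b x y : 'I_r).

Let sym_conn U : connect_sym (induced e U).
Proof. exact/sym_connect_sym/induced_sym. Qed.

Definition component U a := [set v | connect (induced e U) a v].

Lemma component_refl U a : a \in component U a.
Proof. by rewrite inE connect0. Qed.

Lemma component_sub U a : a \in U -> component U a \subset U.
Proof.
move=> aU; apply/subsetP => v; rewrite inE => /connectP[p].
case/path_induced => pU _ ->.
case/lastP: p pU => // p z; rewrite last_rcons; apply.
by rewrite mem_rcons mem_head.
Qed.

Lemma component_closed U a u v :
  u \in component U a -> u \in U -> v \in U -> e u v -> v \in component U a.
Proof.
rewrite !inE => au uU vU euv; apply: connect_trans au (connect1 _).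
by rewrite /induced /= uU vU.
Qed.

(** A path in [U] from [a] never leaves the component, so it is also a path of the graph induced on
    the component. *)
Lemma component_connect U a u v : a \in U ->
  u \in component U a -> v \in component U a ->
  connect (induced e (component U a)) u v.
Proof.
move=> aU; set K := component U a.
suff conn w : w \in K -> connect (induced e K) a w.
  by move=> /conn au /conn av; rewrite (connect_trans _ av) // sym_conn.
have cl : closed (induced e U) [pred w | connect (induced e K) a w].
  apply: intro_closed => [|u' v' /and3P[u'U v'U euv]]; first exact: sym_conn.
  rewrite !inE => au; have u'K : u' \in K.
    have : u' \in component K a by rewrite inE.
    by apply/subsetP/component_sub/component_refl.
  apply: connect_trans au (connect1 _); rewrite /induced /= u'K euv andbT.
  exact: component_closed euv.
by rewrite inE => /(closed_connect cl); rewrite !inE connect0 => <-.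
Qed.

Definition separates U a b S :=
  [&& S \subset U, a \in U :\: S, b \in U :\: S &
      ~~ connect (induced e (U :\: S)) a b].

Lemma separatesC U a b S : separates U a b S = separates U b a S.
Proof. by rewrite /separates sym_conn [(a \in _) && _]andbCA. Qed.

(** Otherwise the component of [a] would stay closed after [x] is put back, and [S :\ x] would still
    separate [a] from [b]. *)
Lemma minimal_separator_neighbor U a b S x :
  minset (separates U a b) S -> x \in S ->
  exists2 u, u \in component (U :\: S) a & e x u.
Proof.
move=> /minsetP[/and4P[SU aU bU nab] Smin] xS; set K := component _ a.
have [/exists_inP[u uK exu]|/exists_inPn none] := boolP [exists u in K, e x u].
  by exists u.
have xU : x \in U by apply: subsetP xS.
have KU : K \subset U :\: S by apply: component_sub.
suff : separates U a b (S :\ x).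
  by move/Smin => /(_ (subsetDl _ _)) E; move: xS; rewrite -E !inE eqxx.
have sub : U :\: S \subset U :\: (S :\ x) by apply/setDS/subsetDl.
rewrite /separates (subset_trans (subsetDl _ _) SU) !(subsetP sub) //=.
apply: contra nab => ab.
have cl : closed (induced e (U :\: (S :\ x))) K.
  apply: intro_closed => [|u v /and3P[uU vU euv] uK]; first exact: sym_conn.
  have vS : v \in U :\: S.
    move: vU; rewrite !inE negb_and negbK => /andP[/orP[/eqP vx|->]->] //.
    by have := none u uK; rewrite -vx e_sym euv.
  exact: component_closed uK (subsetP KU u uK) vS euv.
by have := closed_connect cl ab; rewrite !inE connect0 => <-.
Qed.

Lemma minimal_separator_connect U a b S x y :
  minset (separates U a b) S -> x \in S -> y \in S ->
  connect (induced e (x |: (y |: component (U :\: S) a))) x y.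
Proof.
move=> Smin xS yS; set K := component _ a; set W := x |: (y |: K).
have [u uK exu] := minimal_separator_neighbor Smin xS.
have [v vK eyv] := minimal_separator_neighbor Smin yS.
have aU : a \in U :\: S by case/minsetP: Smin => /and4P[].
have KW : {subset K <= W}.
  by move=> w wK; rewrite !inE in wK *; rewrite wK !orbT.
have xW : x \in W by rewrite !inE eqxx.
have yW : y \in W by rewrite !inE eqxx orbT.
have uv : connect (induced e W) u v.
  apply: connect_sub (component_connect aU uK vK) => u' v' /and3P[u'K v'K euv].
  by apply: connect1; rewrite /induced /= !KW.
apply: connect_trans (connect_trans (connect1 _) uv) (connect1 _).
  by rewrite /induced /= xW KW.
by rewrite /induced /= yW KW //= e_sym.
Qed.

(** The components of [a] and [b] are disjoint with no edge between them, and any two vertices of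
    [S] are connected through each, so chordality makes them adjacent. *)
Lemma minimal_separator_clique U a b S :
  chordal e -> minset (separates U a b) S -> clique e S.
Proof.
move=> e_ch Smin.
have [aU bU nab] : [/\ a \in U :\: S, b \in U :\: S &
    ~~ connect (induced e (U :\: S)) a b].
  by case/minsetP: Smin => /and4P[].
have Smin' : minset (separates U b a) S.
  apply/minsetP; rewrite separatesC; case/minsetP: Smin => sep Smin.
  split=> // B.
  by rewrite separatesC; apply: Smin.
apply/forall_inP => x xS; apply/forall_inP => y yS; apply/implyP => neq.
set Ka := component (U :\: S) a; set Kb := component (U :\: S) b.
have KaU : Ka \subset U :\: S by apply: component_sub.
have KbU : Kb \subset U :\: S by apply: component_sub.
have nK : [disjoint Ka & Kb].
  apply/pred0Pn => -[v /andP[/=]]; rewrite !inE => av; rewrite sym_conn => vb.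
  by case/negP: nab; apply: connect_trans av vb.
have out v : v \in S -> v \notin Ka :|: Kb.
  move=> vS; rewrite inE negb_or; apply/andP; split.
    by apply/negP => /(subsetP KaU); rewrite inE vS.
  by apply/negP => /(subsetP KbU); rewrite inE vS.
apply: (chordal_adjacent e_sym e_ch nK _ (out x xS) (out y yS) neq).
- move=> u v uK vK; apply/negP => euv.
  have := component_closed uK (subsetP KaU u uK) (subsetP KbU v vK) euv.
  by rewrite -/Ka => vKa; have := disjointFr nK vKa; rewrite vK.
- exact: minimal_separator_connect Smin xS yS.
- exact: minimal_separator_connect Smin' xS yS.
Qed.

Lemma chordal_split U : chordal e -> ~~ clique e U ->
  exists U1 U2, [/\ U1 \proper U, U2 \proper U, U = U1 :|: U2,
    clique e (U1 :&: U2) & {in U1 :\: U2 & U2 :\: U1, forall u v, ~~ e u v}].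
Proof.
move=> e_ch /forall_inPn[a aU] /forall_inPn[b bU].
rewrite negb_imply => /andP[neq_ab nab].
(* All of [U] except the nonadjacent [a] and [b] separates them, so a minimal separator exists. *)
have sepU : separates U a b (U :\ a :\ b).
  have UE : U :\: (U :\ a :\ b) = [set a; b].
    apply/setP => v; rewrite !inE !negb_and !negbK.
    by case: eqP => [->|_]; case: eqP => [->|_]; rewrite ?aU ?bU // andNb.
  rewrite /separates UE !inE !eqxx orbT /=; apply/andP; split.
    exact: subset_trans (subsetDl _ _) (subsetDl _ _).
  apply/negP => ab; have cl : closed (induced e [set a; b]) (pred1 a).
    apply: intro_closed => [|u v /and3P[_]]; first exact: sym_conn.
    rewrite !inE => /orP[//|/eqP->] euv /eqP ua.
    by rewrite -ua euv in nab.
  by have := closed_connect cl ab; rewrite !inE eqxx eq_sym (negPf neq_ab).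
have [S Smin _] := minset_exists sepU.
have [SU aS bS nS] := and4P (minsetp Smin).
set K := component (U :\: S) a.
have KU : K \subset U :\: S by apply: component_sub.
have aK : a \in K by apply: component_refl.
(* The first part misses [b], the second misses [a], and they meet in [S]. An edge from [K] to a
   vertex of [U] outside [S] would keep that vertex in [K]. *)
exists (K :|: S), (U :\: K); split.
- apply/properP; split.
    by rewrite subUset SU (subset_trans KU) ?subsetDl.
  exists b => //; rewrite in_setU negb_or inE nS.
  by move: bS; rewrite inE => /andP[].
- apply/properP; split; first exact: subsetDl.
  by exists a => //; rewrite inE aK.
- apply/setP => v; rewrite !in_setU in_setD; have [vK|vK] := boolP (v \in K).
    by have := subsetP KU v vK; rewrite inE => /andP[_ ->].
  by rewrite /=; have [/(subsetP SU)|] := boolP (v \in S).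
- suff -> : (K :|: S) :&: (U :\: K) = S by apply: minimal_separator_clique Smin.
  apply/setP => v; rewrite in_setI in_setU in_setD.
  have [vK|vK] := boolP (v \in K).
    by have := subsetP KU v vK; rewrite inE => /andP[/negPf].
  by rewrite /=; have [/(subsetP SU)|] := boolP (v \in S).
move=> u v; rewrite !in_setD !in_setU negb_or negb_and negbK.
move=> /andP[uKU uKS] /and3P[/andP[vK vS] _ vU].
have uK : u \in K.
  by case/orP: uKU uKS => // uU /orP[//|/(subsetP SU)]; rewrite (negPf uU).
apply/negP => euv; case/negP: vK.
apply: component_closed uK (subsetP KU u uK) _ euv.
by rewrite inE vS.
Qed.
End Separators.

(** * Positive semidefinite completion along a chordal pattern *)

Section Completion.
Variables (R : realType) (r m : nat) (e : rel 'I_r) (f : 'I_m -> 'I_r).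

(** The map [f] sends a matrix index to its vertex, so a blown-up pattern is handled on the original
    graph. Only the entries of [T] at equal or adjacent vertices are prescribed. *)
Lemma chordal_psd_completion (T : 'M[R]_m) :
  symmetric e -> chordal e ->
  (forall A, clique e A -> exists Z, psd_mx Z /\
     {in [pred i | f i \in A] &, forall i j, Z i j = T i j}) ->
  exists Z, psd_mx Z /\
    forall i j, edge_or_diag e (f i) (f j) -> Z i j = T i j.
Proof.
move=> e_sym e_ch T_clique.
suff compl (U : {set 'I_r}) : exists Z, psd_mx Z /\
    {in [pred i | f i \in U] &, forall i j,
      edge_or_diag e (f i) (f j) -> Z i j = T i j}.
  have [Z [Zp ZT]] := compl setT.
  by exists Z; split=> // i j; apply: ZT; rewrite inE /= inE.
have [k] := ubnP #|U|; elim: k U => // k IHk U le_k.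
have [Ucl|/(chordal_split e_sym e_ch)] := boolP (clique e U).
  have [Z [Zp ZT]] := T_clique U Ucl.
  by exists Z; split=> // i j iU jU _; apply: ZT.
case=> U1 [U2 [U1p U2p UE cl12 no12]].
have [|X [Xp XT]] := IHk U1; first by apply: leq_trans (proper_card U1p) _.
have [|Y [Yp YT]] := IHk U2; first by apply: leq_trans (proper_card U2p) _.
pose A := [set i | f i \in U1]; pose B := [set i | f i \in U2].
have cl_edge u v : u \in U1 :&: U2 -> v \in U1 :&: U2 -> edge_or_diag e u v.
  move=> uS vS; rewrite /edge_or_diag; case: eqVneq => //= neq.
  by have /forall_inP/(_ u uS)/forall_inP/(_ v vS)/implyP := cl12; apply.
(* The two parts meet in a clique, so on the overlap every entry is prescribed and both completions
   equal [T]. *)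
have XY : {in A :&: B &, forall i j, X i j = Y i j}.
  move=> i j; rewrite !inE => /andP[i1 i2] /andP[j1 j2].
  have ed : edge_or_diag e (f i) (f j) by apply: cl_edge; rewrite inE ?i1 ?j1.
  by rewrite XT ?YT.
have [Z [Zp ZX ZY]] := psd_glue Xp Yp XY.
exists Z; split=> // i j; rewrite !inE UE !inE => iU jU ed.
have [/andP[i1 j1]|n1] := boolP ((f i \in U1) && (f j \in U1)).
  by rewrite ZX ?inE // XT.
have [/andP[i2 j2]|n2] := boolP ((f i \in U2) && (f j \in U2)).
  by rewrite ZY ?inE // YT.
(* What remains is a pair with one vertex in each difference [U1 :\: U2], [U2 :\: U1], where no edge
   exists. *)
have neq : f i != f j.
  by apply: contraTneq iU => E; rewrite -E !andbb in n1 n2; rewrite (negPf n1).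
move: ed; rewrite /edge_or_diag (negPf neq) /= => ed.
have ed' := ed; rewrite e_sym in ed'.
move: n1 n2; rewrite !negb_and.
case/orP: iU => iU; case/orP: jU => jU; rewrite ?iU ?jU //= ?orbF => n1 n2.
- by move: (no12 (f i) (f j)); rewrite !inE n1 n2 iU jU ed => /(_ isT isT).
- by move: (no12 (f j) (f i)); rewrite !inE n1 n2 iU jU ed' => /(_ isT isT).
Qed.
End Completion.

(** * Blow-ups and Gram matrices *)

Lemma enum_ord_sorted m (A : {pred 'I_m}) :
  sorted (relpre (@nat_of_ord m) ltn) (enum A).
Proof.
rewrite /enum_mem; apply: sorted_filter => [x y z|]; first exact: ltn_trans.
by rewrite -enumT -sorted_map val_enum_ord iota_ltn_sorted.
Qed.

(** The values of [f] and the enumeration of [A] are strictly sorted lists with the same elements.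
    This identifies explicit formulas with [enum_val]. *)
Lemma enum_val_unique m (A : {set 'I_m}) (f : 'I_#|A| -> 'I_m) :
  {homo f : i j / (i < j)%N} -> (forall i, f i \in A) -> f =1 enum_val.
Proof.
move=> f_mono fA.
have f_inj : injective f.
  move=> i j eq_f; apply/val_inj/eqP.
  rewrite eqn_leq leqNgt [X in _ && X]leqNgt.
  by apply/andP; split; apply/negP => /f_mono; rewrite eq_f ltnn.
have eq_enum : map f (enum 'I_#|A|) = enum A.
  apply: (@irr_sorted_eq _ (relpre (@nat_of_ord m) ltn)).
  - by move=> x y z; apply: ltn_trans.
  - by move=> x; rewrite /= ltnn.
  - rewrite sorted_map.
    by apply: sub_sorted (enum_ord_sorted _) => i j; apply: f_mono.
  - exact: enum_ord_sorted.
  - have sub : {subset map f (enum 'I_#|A|) <= enum A}.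
      by move=> _ /mapP[i _ ->]; rewrite mem_enum.
    have [||_ E x] := uniq_min_size _ sub; rewrite ?E //.
      by rewrite map_inj_uniq ?enum_uniq.
    by rewrite size_map -!cardE card_ord.
move=> i.
by rewrite /enum_val -eq_enum (nth_map i) ?size_enum_ord // nth_ord_enum.
Qed.

Section Blowup.
Variables (r N : nat).
Implicit Type A : {set 'I_r}.

Lemma in_blowup A i : (i \in blowup N A) = ((mxtens_unindex i).1 \in A).
Proof.
have N0 : (0 < N)%N.
  rewrite lt0n; apply: contraTneq (ltn_ord i) => N0.
  have rN0 : (r * N = 0)%N by rewrite N0 muln0.
  by rewrite [X in (_ < X)%N]rN0.
rewrite inE; apply/existsP/idP => [[j /and3P[jA le_i lt_i]]|iA].
  suff -> : (mxtens_unindex i).1 = j by [].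
  apply/val_inj/eqP; rewrite /= eqn_leq leq_divRL // le_i andbT.
  by rewrite -ltnS ltn_divLR.
exists (mxtens_unindex i).1; rewrite iA /= leq_divM /=.
by rewrite -ltn_divLR.
Qed.

(* The index selected by row b of blowup_mx: the lexicographic order on pairs
   (j, l) of a vertex and a monomial index is the order of j N + l. *)
Definition blowup_val A (b : 'I_(#|A| * N)) : 'I_(r * N) :=
  mxtens_index (enum_val (mxtens_unindex b).1, (mxtens_unindex b).2).

Arguments blowup_val : clear implicits.

Lemma blowup_valK A b : mxtens_unindex (blowup_val A b) =
  (enum_val (mxtens_unindex b).1, (mxtens_unindex b).2).
Proof. exact: mxtens_indexK. Qed.

Lemma blowup_valP A b : blowup_val A b \in blowup N A.
Proof. by rewrite in_blowup mxtens_indexK enum_valP. Qed.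

Lemma enum_val_ltn A : {homo (@enum_val _ (mem A)) : i j / (i < j)%N}.
Proof.
move=> i j lt_ij; have x0 := enum_val i.
rewrite !(enum_val_nth x0).
have tr : transitive (relpre (@nat_of_ord r) ltn).
  by move=> x y z; apply: ltn_trans.
move: (enum_ord_sorted (mem A)) => /(sorted_ltn_nth tr x0).
by apply; rewrite ?inE -?cardE.
Qed.

Lemma blowup_val_enum A b :
  blowup_val A b = enum_val (cast_ord (esym (card_blowup N A)) b).
Proof.
pose f (c : 'I_#|blowup N A|) := blowup_val A (cast_ord (card_blowup N A) c).
suff /(_ (cast_ord (esym (card_blowup N A)) b)) : f =1 enum_val.
  by rewrite /f cast_ordKV.
apply: enum_val_unique => [i j lt_ij|i]; last exact: blowup_valP.
have lex k l s u : (k < l)%N -> (s < N)%N -> (k * N + s < l * N + u)%N.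
  move=> lt_kl lt_s; apply: (@leq_trans (k.+1 * N)).
    by rewrite mulSn addnC ltn_add2r.
  by rewrite (leq_trans _ (leq_addr _ _)) // leq_mul2r lt_kl orbT.
rewrite /f.
have : (cast_ord (card_blowup N A) i < cast_ord (card_blowup N A) j)%N by [].
move: (cast_ord _ i) (cast_ord _ j) => {lt_ij}.
move=> {}i {}j; case: (mxtens_indexP i) => i1 i2.
case: (mxtens_indexP j) => j1 j2.
rewrite /blowup_val !mxtens_indexK /= => lt_ij.
have [lt1|gt1|/val_inj eq1] := ltngtP i1 j1.
- exact: lex (enum_val_ltn lt1) (ltn_ord i2).
- by rewrite ltnNge ltnW ?lex in lt_ij.
- by move: lt_ij; rewrite eq1 !ltn_add2l.
Qed.

(** As a row selection of the identity, the matrix acts by reindexing, and products with it need no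
    sums. *)
Lemma blowup_mxE (K : nzRingType) A :
  blowup_mx K N A = rowsub (blowup_val A) 1%:M.
Proof.
by apply/matrixP => i j; rewrite castmxE !mxE blowup_val_enum cast_ord_id.
Qed.

Lemma index_mxE (K : nzRingType) m (A : {set 'I_m}) :
  index_mx K A = rowsub enum_val 1%:M.
Proof. by apply/matrixP => i j; rewrite !mxE. Qed.

Lemma index_mx_congr (K : nzRingType) m (A : {set 'I_m}) (X : 'M[K]_m) i j :
  (index_mx K A *m X *m (index_mx K A)^T) i j = X (enum_val i) (enum_val j).
Proof.
rewrite index_mxE mul_rowsub_mx mul1mx trmx_mxsub trmx1 mulmx_colsub mulmx1.
by rewrite !mxE.
Qed.

Lemma blowup_mx_congr (K : nzRingType) A (X : 'M[K]_(r * N)) i j :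
  (blowup_mx K N A *m X *m (blowup_mx K N A)^T) i j
  = X (blowup_val A i) (blowup_val A j).
Proof.
rewrite blowup_mxE mul_rowsub_mx mul1mx trmx_mxsub trmx1 mulmx_colsub mulmx1.
by rewrite !mxE.
Qed.

Lemma blowup_val_inj A : injective (blowup_val A).
Proof.
by move=> i j; rewrite !blowup_val_enum => /enum_val_inj/cast_ord_inj.
Qed.

Lemma blowup_val_surj A a :
  a \in blowup N A -> exists b : 'I_(#|A| * N), a = blowup_val A b.
Proof.
move=> aA; exists (cast_ord (card_blowup N A) (enum_rank_in aA a)).
by rewrite blowup_val_enum cast_ordK enum_rankK_in.
Qed.

Lemma blowup_mxK (K : nzRingType) A :
  blowup_mx K N A *m (blowup_mx K N A)^T = 1%:M.
Proof.
apply/matrixP => i j; have := @blowup_mx_congr K A 1%:M i j.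
by rewrite mulmx1 => ->; rewrite !mxE (inj_eq (@blowup_val_inj A)).
Qed.
End Blowup.
Arguments blowup_val {r N} A b.

(** * Monomial vectors and Gram matrices of SOS matrices *)

Section Gram.
Variables (R : realType) (n d : nat).
Local Notation N := (nb_monomials n d).
Local Notation "A ^P" := (map_mx (@mpolyC n R) A) (at level 1, format "A ^P").

Lemma monomial_mxE q a j : monomial_mx R n d q a j =
  ((mxtens_unindex a).1 == j)%:R *
  'X_[nth 0%MM (monomials n d) (mxtens_unindex a).2].
Proof.
rewrite castmxE cast_ord_id !mxE; congr ((_ == _)%:R * _).
by apply: val_inj; rewrite /= divn1.
Qed.

(** Restricting to the vertices of [A] commutes with attaching monomials. Rows outside the blow-up
    vanish on both sides; in a row inside it, a single term of the product survives. *)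
Lemma monomial_mx_index r (A : {set 'I_r}) :
  monomial_mx R n d r *m (index_mx _ A)^T =
  (blowup_mx R N A)^P^T *m monomial_mx R n d #|A|.
Proof.
have -> : (blowup_mx R N A)^P = rowsub (blowup_val A) 1%:M.
  by rewrite blowup_mxE map_mxsub map_mx1.
rewrite index_mxE !trmx_mxsub !trmx1 mulmx_colsub mulmx1.
apply/matrixP => a k; rewrite !mxE monomial_mxE.
have [aA|aA] := boolP (a \in blowup N A).
  have [b ->] := blowup_val_surj aA; rewrite blowup_valK.
  rewrite (bigD1 b) // !mxE eqxx mul1r big1 => [|b' neq].
    by rewrite [RHS]addr0 monomial_mxE (inj_eq enum_val_inj).
  by rewrite !mxE (inj_eq (@blowup_val_inj _ _ A)) eq_sym (negPf neq) mul0r.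
rewrite big1 => [|b _]; last first.
  rewrite !mxE; case: eqP => [E|_]; last by rewrite mul0r.
  by rewrite E blowup_valP in aA.
case: eqP => [E|_]; last by rewrite mul0r.
by rewrite in_blowup E enum_valP in aA.
Qed.

Lemma msizeM_deg a b (p q : {mpoly R[n]}) :
  (msize p <= a.+1)%N -> (msize q <= b.+1)%N -> (msize (p * q) <= (a + b).+1)%N.
Proof.
have [->|p0] := eqVneq p 0; first by rewrite mul0r msize0.
have [->|q0] := eqVneq q 0; first by rewrite mulr0 msize0.
by rewrite msizeM //; move: (msize p) (msize q) => x y; lia.
Qed.

Lemma msize_sum_le (I : finType) (F : I -> {mpoly R[n]}) k :
  (forall i, (msize (F i) <= k)%N) -> (msize (\sum_i F i) <= k)%N.
Proof.
by move=> Fk; apply: leq_trans (mmeasure_sum _ _ _ _) _; apply/bigmax_leqP.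
Qed.

Lemma deg_le_mul a b q s t (A : 'M[{mpoly R[n]}]_(q, s)) (B : 'M_(s, t)) :
  deg_le a A -> deg_le b B -> deg_le (a + b) (A *m B).
Proof.
by move=> Aa Bb i j; rewrite mxE msize_sum_le // => k; apply: msizeM_deg.
Qed.

Lemma deg_le_const q s (A : 'M[R]_(q, s)) : deg_le 0 A^P.
Proof. by move=> i j; rewrite mxE msizeC; case: (_ == _). Qed.

Lemma deg_le_monomial_mx q : deg_le d (monomial_mx R n d q).
Proof.
move=> a j; rewrite monomial_mxE; case: eqP => _; last by rewrite mul0r msize0.
rewrite mul1r msizeX ltnS -mem_monomials mem_nth // size_monomials.
exact: ltn_ord.
Qed.

Lemma sos_mx_gram q s (M : 'M[{mpoly R[n]}]_(s.+1, q)) :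
  deg_le d M -> sos_mx d (M^T *m M).
Proof.
move=> Md; split; first by rewrite trmx_mul trmxK.
  by rewrite mul2n -addnn; apply: deg_le_mul => // i j; rewrite mxE.
by exists s.+1; split=> //; exists M.
Qed.

(** Row [i] of [L] lists the coefficients of the entries in row [i] of [M], one block of monomials
    per column. *)
Lemma deg_le_monomial_mul q s (M : 'M[{mpoly R[n]}]_(s, q)) :
  deg_le d M -> exists L : 'M[R]_(s, q * N), M = L^P *m monomial_mx R n d q.
Proof.
move=> Md; pose mon (l : 'I_N) := nth 0%MM (monomials n d) l.
exists (\matrix_(i, a) (M i (mxtens_unindex a).1)@_(mon (mxtens_unindex a).2)).
apply/matrixP => i j; rewrite mxE.
have -> : M i j = \sum_(l < N) (M i j)@_(mon l) *: 'X_[mon l].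
  rewrite {1}[M i j](mpolywE (Md i j)).
  transitivity (\sum_(m <- monomials n d) (M i j)@_m *: 'X_[m]).
    rewrite (perm_big _ (permEl (perm_sort _ _))) big_map big_enum //=.
  rewrite (big_nth 0%MM) size_monomials big_mkord //.
pose G (k : 'I_q) l := ((M i k)@_(mon l))%:MP * ((k == j)%:R * 'X_[mon l]).
rewrite (reindex (@mxtens_index q N)); last first.
  by exists (@mxtens_unindex q N) => ? _;
    rewrite (mxtens_indexK, mxtens_unindexK).
transitivity (\sum_(p : 'I_q * 'I_N) G p.1 p.2); last first.
  by apply: eq_bigr => p _; rewrite monomial_mxE !mxE mxtens_indexK.
rewrite -(pair_bigA _ G) (bigD1 j) //= [X in _ + X]big1 => [|k neq]; last first.
  by rewrite big1 // => l _; rewrite /G (negPf neq) mul0r mulr0.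
rewrite addr0; apply: eq_bigr => l _.
by rewrite /G eqxx mul1r mul_mpolyC.
Qed.

(** A factorization [Z = L^T L] makes [L (I (x) v)] a square root; [sos_gram] reads the same
    identity backwards. *)
Lemma psd_gram_sos q (Z : 'M[R]_(q * N)) :
  psd_mx Z -> sos_mx d ((monomial_mx R n d q)^T *m Z^P *m monomial_mx R n d q).
Proof.
move=> /psd_factor[s [L ->]]; set M := monomial_mx R n d q.
have -> : M^T *m (L^T *m L)^P *m M = (L^P *m M)^T *m (L^P *m M).
  by rewrite map_mxM -map_trmx trmx_mul !mulmxA.
apply: sos_mx_gram.
exact: (deg_le_mul (@deg_le_const _ _ _) (@deg_le_monomial_mx _)).
Qed.

Lemma sos_gram q (P : 'M[{mpoly R[n]}]_q) :
  sos_mx d P -> exists Z : 'M[R]_(q * N), gram_mx P Z.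
Proof.
case=> _ _ [s [_ [M [/deg_le_monomial_mul[L ->] ->]]]].
exists (L^T *m L); split; first exact: psd_gram.
by rewrite map_mxM -map_trmx trmx_mul !mulmxA.
Qed.

(** Links the two scales: a principal submatrix over vertices corresponds to the principal submatrix
    of [Z] over their blocks. *)
Lemma index_mx_gram r (A : {set 'I_r}) (Z : 'M[R]_(r * N)) :
  index_mx _ A *m ((monomial_mx R n d r)^T *m Z^P *m monomial_mx R n d r)
    *m (index_mx _ A)^T
  = (monomial_mx R n d #|A|)^T
    *m (blowup_mx R N A *m Z *m (blowup_mx R N A)^T)^P
    *m monomial_mx R n d #|A|.
Proof.
have E := monomial_mx_index A.
rewrite -!mulmxA E !mulmxA -[index_mx _ A]trmxK -trmx_mul E trmx_mul trmxK.
by rewrite !map_mxM -map_trmx !mulmxA.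
Qed.

End Gram.

Lemma blowup_mx_lift (K : nzRingType) r N (A : {set 'I_r})
    (Q : 'M[K]_(#|A| * N)) i j :
  ((blowup_mx K N A)^T *m Q *m blowup_mx K N A)
    (blowup_val A i) (blowup_val A j)
  = Q i j.
Proof.
rewrite -blowup_mx_congr !mulmxA blowup_mxK mul1mx -mulmxA blowup_mxK.
by rewrite mulmx1.
Qed.

(** Turns the consistency condition into entrywise equality on the intersection of two blow-ups. *)
Lemma index_mx_congr_eq0P (K : nzRingType) m (A : {set 'I_m}) (X : 'M[K]_m) :
  index_mx K A *m X *m (index_mx K A)^T = 0 <-> {in A &, forall i j, X i j = 0}.
Proof.
split=> [X0 i j iA jA | X0].
  have := congr1
    (fun Y : 'M_#|A| => Y (enum_rank_in iA i) (enum_rank_in jA j)) X0.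
  by rewrite index_mx_congr !enum_rankK_in ?mxE.
by apply/matrixP => i j; rewrite index_mx_congr X0 ?mxE ?enum_valP.
Qed.

Lemma clique_edge r (e : rel 'I_r) A i j :
  clique e A -> i \in A -> j \in A -> edge_or_diag e i j.
Proof.
move=> /forall_inP clA iA jA; rewrite /edge_or_diag; case: eqVneq => //= neq.
by have /forall_inP/(_ j jA)/implyP := clA i iA; apply.
Qed.

Lemma edge_clique r (e : rel 'I_r) i j :
  symmetric e -> edge_or_diag e i j -> clique e [set i; j].
Proof.
move=> e_sym ed; apply/forall_inP => x; rewrite !inE => /orP xij.
apply/forall_inP => y; rewrite !inE => /orP yij; apply/implyP => neq.
move: ed neq; rewrite /edge_or_diag.
case: xij => /eqP->; case: yij => /eqP->; rewrite ?eqxx //.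
  by case/orP => [->|].
by rewrite eq_sym e_sym => /orP[->|].
Qed.

Theorem theorem4 (R : realType) (n d r : nat)
    (n_gt0 : (0 < n)%N) (d_gt0 : (0 < d)%N) (r_gt0 : (0 < r)%N)
    (e : rel 'I_r) (e_sym : symmetric e) (e_chordal : chordal e)
    (t : nat) (C : 'I_t -> {set 'I_r}) (C_max : maximal_cliques_are e C)
    (P : 'M[{mpoly R[n]}]_r) (P_sym : P^T = P)
    (P_pattern : forall i j, ~~ edge_or_diag e i j -> P i j = 0 /\ P j i = 0) :
  let N := nb_monomials n d in
  let Pk (k : 'I_t) : 'M[{mpoly R[n]}]_#|C k| :=
    index_mx {mpoly R[n]} (C k) *m P *m (index_mx {mpoly R[n]} (C k))^T in
  sos_completable e d P <->
  ((forall k, sos_mx d (Pk k)) /\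
   exists Q : forall k : 'I_t, 'M[R]_(#|C k| * N),
     (forall k, gram_mx (Pk k) (Q k)) /\
     forall i j : 'I_t,
       let Cij := blowup N (C i) :&: blowup N (C j) in
       Cij != set0 ->
       index_mx R Cij *m
         ((blowup_mx R N (C i))^T *m Q i *m blowup_mx R N (C i) -
          (blowup_mx R N (C j))^T *m Q j *m blowup_mx R N (C j)) *m
         (index_mx R Cij)^T = 0).
Proof.
move=> N Pk.
have C_clique k : clique e (C k).
  have /maxsetP[] // : maximal_clique e (C k).
  by apply/(proj2 C_max); exists k.
have clique_sub A : clique e A -> exists k, A \subset C k.
  move=> /maxset_exists[B Bmax AB].
  by have [k Ck] := proj1 (proj2 C_max B) Bmax; exists k; rewrite Ck.
pose B k := blowup_mx R N (C k).
split=> [[_ _ [F [Fsos FP]]] | [_ [Q [Qgram Qcons]]]].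
  have [Z [Zp FZ]] := sos_gram Fsos.
  (* All the Gram matrices are cut from one Gram matrix [Z] of the completion, so their lifts agree
     with [Z] wherever they overlap. *)
  pose Q k := B k *m Z *m (B k)^T.
  have Qp k : psd_mx (Q k) by have := psd_congr (B k)^T Zp; rewrite trmxK.
  have PkQ k : Pk k = (monomial_mx R n d _)^T *m map_mx (@mpolyC n R) (Q k)
                      *m monomial_mx R n d _.
    rewrite -index_mx_gram -FZ; apply/matrixP => i j; rewrite !index_mx_congr.
    by rewrite FP // (clique_edge (C_clique k)) ?enum_valP.
  split=> [k|]; first by rewrite PkQ; apply: psd_gram_sos.
  exists Q; split=> [k|i j Cij _]; first by split; last exact: PkQ.
  apply/index_mx_congr_eq0P => a b; rewrite !in_setI.
  have lift_Q k : a \in blowup N (C k) -> b \in blowup N (C k) ->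
      ((B k)^T *m Q k *m B k) a b = Z a b.
    move=> /blowup_val_surj[a' ->] /blowup_val_surj[b' ->].
    by rewrite blowup_mx_lift blowup_mx_congr.
  move=> /andP[ai aj] /andP[bi bj].
  by rewrite [LHS]mxE [X in _ + X]mxE -/(B i) -/(B j) !lift_Q // subrr.
pose hQ k := (B k)^T *m Q k *m B k.
have hQp k : psd_mx (hQ k) by apply/psd_congr/(proj1 (Qgram k)).
(* The partial matrix takes an entry from some clique containing both blocks; 0 stands for an
   unspecified entry. By consistency the choice of clique does not matter. *)
pose T := \matrix_(a, b)
  if [pick k | (a \in blowup N (C k)) && (b \in blowup N (C k))] is Some k
  then hQ k a b else 0.
have TQ k a b :
    a \in blowup N (C k) -> b \in blowup N (C k) -> T a b = hQ k a b.
  move=> ak bk; rewrite mxE.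
  case: pickP => [k' /andP[ak' bk']|/(_ k)]; last by rewrite ak bk.
  have ne : blowup N (C k') :&: blowup N (C k) != set0.
    by apply/set0Pn; exists a; rewrite in_setI ak ak'.
  have /index_mx_congr_eq0P/(_ a b) := Qcons k' k ne.
  rewrite !in_setI ak ak' bk bk' -/(B k) -/(B k') -/(hQ k) -/(hQ k').
  move=> /(_ isT isT)/eqP; rewrite mxE [X in _ + X]mxE subr_eq0 => /eqP.
  exact.
pose f (a : 'I_(r * N)) := (mxtens_unindex a).1.
have [|Z [Zp ZT]] := @chordal_psd_completion R _ _ e f T e_sym e_chordal.
  move=> A /clique_sub[k AC]; exists (hQ k); split=> // a b aA bA.
  by rewrite (TQ k) // in_blowup (subsetP AC).
split=> //; exists ((monomial_mx R n d r)^T *m map_mx (@mpolyC n R) Z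
  *m monomial_mx R n d r).
split=> [|i j ed]; first exact: psd_gram_sos.
(* Every specified entry lies in the submatrix of some maximal clique, so it suffices that [Z]
   restricts to [Q k] there. *)
have [k sub] := clique_sub _ (edge_clique e_sym ed).
have iC : i \in C k by apply: (subsetP sub); rewrite !inE eqxx.
have jC : j \in C k by apply: (subsetP sub); rewrite !inE eqxx orbT.
have Ei := enum_rankK_in iC iC; have Ej := enum_rankK_in jC jC.
rewrite -Ei -Ej -!index_mx_congr index_mx_gram.
suff -> : blowup_mx R N (C k) *m Z *m (blowup_mx R N (C k))^T = Q k.
  by rewrite -(proj2 (Qgram k)).
apply/matrixP => a b; rewrite blowup_mx_congr -[RHS]blowup_mx_lift.
rewrite ZT ?(TQ k) ?blowup_valP // /f !blowup_valK.
by apply: clique_edge (C_clique k) _ _; apply: enum_valP.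
Qed.
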